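(* For every integer $n \geq 1$, let $B_n^{(3)}$ be the triangular book graph with vertex set $\{a, b, c_1, \dots, c_n\}$ and edge set $\{ab\} \cup \{ac_i, bc_i : 1 \leq i \leq n\}$ (order $n+2$, size $2n+1$). Then $$ms\left(B_n^{(3)}\right) = \begin{cases} 3, & \text{if } n = 1, \\ 4, & \text{if } n = 5, \\ \infty, & \text{if } n \equiv 0 \pmod 4, \\ \left\lceil \frac{n+1}{2} \right\rceil, & \text{otherwise.} \end{cases}$$
   Context: The triangular book graph $B_n^{(3)}$ consists of $n$ triangles sharing a common edge $ab$. Let $G$ be a graph of order $N$ with no component of order at most $2$. An edge $k$-labeling $f: E(G) \to \{1, 2, \dots, k\}$ is a modular irregular $k$-labeling of $G$ if the map $w_f: V(G) \to \mathbb{Z}_N$, $w_f(x) = \left(\sum_{xy \in E(G)} f(xy)\right) \bmod N$ (the modular weight of $x$), is a bijection onto $\mathbb{Z}_N$, the group of integers modulo $N$. The modular irregularity strength $ms(G)$ is the minimum $k$ for which $G$ admits a modular irregular $k$-labeling, and $ms(G) = \infty$ if $G$ admits no modular irregular labeling. *)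

(* Defs.v *)
From mathcomp Require Import all_boot.
From mathcomp Require Import boolp.

Set Implicit Arguments.
Unset Strict Implicit.
Unset Printing Implicit Defensive.

Record sgraph := SGraph {
  vertex : finType;
  edges : {set {set vertex}};
  edges_card : forall E, E \in edges -> #|E| = 2
}.

Section ModularIrregularity.
Variable G : sgraph.
Implicit Types (f : {set vertex G} -> nat) (k : nat).

Definition adj : rel (vertex G) := fun x y => [set x; y] \in edges G.

Definition no_small_component : Prop :=
  forall x, 2 < #|[set y | connect adj x y]|.

(* Only the values of [f] on edges matter, here and in the weights. *)
Definition edge_labeling k f : Prop :=
  forall E, E \in edges G -> 1 <= f E <= k.

Lemma order_gt0 (x : vertex G) : 0 < #|vertex G|.
Proof. by apply/card_gt0P; exists x. Qed.

(* Z_N is represented by its canonical residues 'I_N: unlike 'Z_N, this is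
   correct for every order N. *)
Definition modular_weight f (x : vertex G) : 'I_#|vertex G| :=
  Ordinal (ltn_pmod (\sum_(y | [set x; y] \in edges G) f [set x; y])
                    (order_gt0 x)).

Definition modular_irregular_labeling k f : Prop :=
  edge_labeling k f /\ bijective (modular_weight f).

Definition has_modular_irregular_labeling k : Prop :=
  exists f, modular_irregular_labeling k f.

(* [None] stands for infinity. *)
Definition ms : option nat :=
  match pselect (exists k, `[< has_modular_irregular_labeling k >]) with
  | left ex => Some (ex_minn ex)
  | right _ => None
  end.

End ModularIrregularity.

Section Book.
Variable n : nat.

Definition book_vertex : finType := (bool + 'I_n)%type.
Definition book_a : book_vertex := inl false.
Definition book_b : book_vertex := inl true.
Definition book_c (i : 'I_n) : book_vertex := inr i.

Definition book_edges : {set {set book_vertex}} :=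
  [set book_a; book_b]
    |: ([set [set book_a; book_c i] | i : 'I_n]
        :|: [set [set book_b; book_c i] | i : 'I_n]).

Lemma book_edges_card E : E \in book_edges -> #|E| = 2.
Proof.
by case/setU1P=> [->|/setUP[]/imsetP[i _ ->]]; rewrite cards2.
Qed.

Definition triangular_book : sgraph := SGraph book_edges_card.

Lemma card_book_vertex : #|vertex triangular_book| = n + 2.
Proof. by rewrite /= card_sum card_bool card_ord addnC. Qed.

Lemma card_book_edges : #|edges triangular_book| = 2 * n + 1.
Proof.
have neq (x y : bool) (i : 'I_n) :
    [set inl x; inl y] != [set inl x; inr i] :> {set book_vertex}.
  by apply/eqP => /setP/(_ (inr i)); rewrite !inE eqxx.
have inj (x : bool) : injective (fun i => [set inl x; inr i] : {set book_vertex}).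
  by move=> i j /setP/(_ (inr i)); rewrite !inE eqxx /= => /esym/eqP[].
rewrite /= cardsU1 cardsU !card_imset ?card_ord; [|exact: inj|exact: inj].
rewrite (_ : _ :&: _ = set0); last first.
  apply/setP=> E; rewrite !inE; apply/andP=> -[/imsetP[i _ ->] /imsetP[j _]].
  by move/setP/(_ book_a); rewrite !inE eqxx.
rewrite (_ : _ \notin _) ?cards0 ?subn0; first by rewrite addnC mul2n addnn.
rewrite inE negb_or; apply/andP; split; apply/imsetP=> -[i _ /eqP].
  by apply/negP/neq.
by rewrite setUC; apply/negP/neq.
Qed.

Lemma book_no_small_component : 0 < n -> no_small_component triangular_book.
Proof.
move=> n_gt0 x; pose i0 := Ordinal n_gt0.
have eab : [set book_a; book_b] \in book_edges by rewrite setU11.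
have eac i : [set book_a; book_c i] \in book_edges.
  by rewrite setU1r // inE; apply/orP; left; apply/imsetP; exists i.
have ebc i : [set book_b; book_c i] \in book_edges.
  by rewrite setU1r // inE; apply/orP; right; apply/imsetP; exists i.
have a_all (y : vertex triangular_book) : connect (@adj triangular_book) book_a y.
  by case: y => [[]|i]; rewrite ?connect0 //; apply: connect1; rewrite /adj.
have symc : connect_sym (@adj triangular_book).
  by apply: sym_connect_sym => u v; rewrite /adj setUC.
rewrite (_ : [set y | _] = setT); last first.
  apply/setP=> y; rewrite !inE; apply: connect_trans (a_all y).
  by rewrite symc.
by rewrite cardsT card_book_vertex addn2.
Qed.

End Book.

(* Main.v *)
Require Import Defs.
From mathcomp Require Import boolp.
From mathcomp Require Import all_boot perm zify.

(** Label the spine [ab] by [e], and write [x p i] for the label of the edge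
    joining [c_i] to the endpoint [p] of the spine.

    Lower bounds: vertices of equal degree [d] have distinct weights between [d]
    and [d * k], so [n <= 2 * k - 1].  By the handshake lemma the weights have
    an even sum, whereas [0 + ... + (N - 1)] is odd when [N = n + 2] is [2]
    modulo [4].  For [n = 5] and [k = 3] the weights of the [c_i] exhaust
    [2 .. 6], which confines both sums [\sum_i x p i] to [8 .. 12] and leaves
    the residues [0] and [1] modulo [7] to [a] and [b]; this forces [e = 1], and
    then neither sum is possible.

    Constructions: give [c_i] the weight [i + 2], leaving [0] and [1] to [a] and
    [b].  Once [e] makes the total weight right it suffices that [a] has weight
    [0].  The sum of the [x false i] takes every value of an interval, which for
    the optimal [k] has length [(k - 1) ^ 2], hence meets every residue class
    modulo [n + 2] as soon as [k >= 4]. *)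

Set Implicit Arguments.
Unset Strict Implicit.
Unset Printing Implicit Defensive.

Lemma exists_sum_eq (I : finType) (lo hi : I -> nat) t :
  (forall i, lo i <= hi i) -> \sum_i lo i <= t <= \sum_i hi i ->
  exists2 x : I -> nat, forall i, lo i <= x i <= hi i & \sum_i x i = t.
Proof.
move=> + /andP[lo_t t_hi].
have [m t_eq] : exists m, t = \sum_i lo i + m.
  by exists (t - \sum_i lo i); rewrite subnKC.
elim: m lo {lo_t} t_eq => [|m IH] lo t_eq lo_hi.
  by exists lo; [move=> i; rewrite leqnn lo_hi | rewrite t_eq addn0].
have [i0 lo_lt_hi] : exists i, lo i < hi i.
  apply/existsP; apply: contraT => /existsPn hi_lo.
  suff : \sum_i hi i <= \sum_i lo i by lia.
  by apply: leq_sum => i _; rewrite leqNgt.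
have [| i |x x_bounds sum_x] := IH (fun i => lo i + (i == i0)).
- by rewrite big_split /= -big_mkcond big_pred1_eq t_eq; lia.
- by case: eqP => [->|_]; [lia | rewrite addn0].
by exists x => // i; have := x_bounds i; lia.
Qed.

Lemma exists_dvdn_addn_between d m a b :
  0 < d -> a + d.-1 <= b -> exists2 t, a <= t <= b & d %| m + t.
Proof.
move=> d_gt0 ab; pose r := (m + a + d.-1) %% d.
have r_lt : r < d by rewrite ltn_mod.
exists (a + (d.-1 - r)); first lia.
rewrite (_ : m + _ = (m + a + d.-1) %/ d * d) ?dvdn_mull //.
by have := divn_eq (m + a + d.-1) d; rewrite -/r; lia.
Qed.

Lemma inj_ltn_perm n (s : 'I_n -> nat) :
  injective s -> (forall i, s i < n) -> exists p : 'S_n, forall i, s i = p i.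
Proof.
move=> s_inj s_lt; have s_ord_inj : injective (fun i => Ordinal (s_lt i)).
  by move=> i j [/s_inj].
by exists (perm s_ord_inj) => i; rewrite permE.
Qed.

Lemma mul2_bin2 n : 2 * 'C(n, 2) = n * n.-1.
Proof. by rewrite mulnC (bin_ffact n 2) ffactnS ffactn1. Qed.

Lemma odd_bin2 n : n = 2 %[mod 4] -> odd 'C(n, 2).
Proof.
by move=> n_mod4; have := mul2_bin2 n; rewrite (divn_eq n 4) n_mod4; nia.
Qed.

Lemma sum_succ_subn n k : \sum_(i < n) (i.+1 - k) = 'C(n.+1 - k, 2).
Proof.
elim: n => [|n IH]; first by rewrite big_ord0 bin_small //; lia.
rewrite big_ord_recr /= IH; case: (leqP k n.+1) => [k_le|k_gt].
  by rewrite (subSn k_le) binS bin1 addnC.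
by rewrite !bin_small; lia.
Qed.

Lemma sum_succ n : \sum_(i < n) i.+1 = 'C(n.+1, 2).
Proof.
by rewrite -(sum_succ_subn n 0); apply: eq_bigr => i _; rewrite subn0.
Qed.

Section ModularLabelings.
Variables (G : sgraph) (k : nat) (f : {set vertex G} -> nat).

Definition weight (x : vertex G) : nat :=
  \sum_(y | [set x; y] \in edges G) f [set x; y].

Definition degree (x : vertex G) : nat := #|[set y | adj x y]|.

Lemma weight_sum_edges x : weight x = \sum_(E in edges G | x \in E) f E.
Proof.
have pair_inj : injective (fun y => [set x; y]).
  move=> y z eq_yz.
  have : y \in [set x; z] by rewrite -eq_yz set22.
  have : z \in [set x; y] by rewrite eq_yz set22.
  by rewrite !inE => /orP[]/eqP-> // /orP[]/eqP.
rewrite /weight -big_set -(big_imset f (in2W pair_inj)).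
apply: eq_bigl => E; apply/imsetP/andP => [[y xy_edge ->]|[E_edge xE]].
  by rewrite set21; rewrite inE in xy_edge.
have /eqP/cards2P[u [v [_ E_uv]]] := edges_card E_edge.
move: E_edge xE; rewrite E_uv !inE => uv_edge /orP[]/eqP->.
  by exists v; rewrite ?inE.
by exists u; rewrite 1?setUC // inE setUC.
Qed.

Lemma sum_weight : \sum_x weight x = 2 * \sum_(E in edges G) f E.
Proof.
under eq_bigr => x _ do rewrite weight_sum_edges.
rewrite (exchange_big_dep (fun E => E \in edges G)) => [|x E _ /andP[]//].
rewrite big_distrr /=; apply: eq_bigr => E E_edge.
rewrite -(edges_card E_edge) -sum_nat_const.
by apply: eq_bigl => x; rewrite E_edge.
Qed.

Lemma weight_bounds x :
  edge_labeling k f -> degree x <= weight x <= k * degree x.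
Proof.
move=> f_range; rewrite /degree /weight mulnC -sum_nat_const -sum1_card.
under [X in X <= _ <= _]eq_bigl => y do rewrite inE.
under [X in _ <= _ <= X]eq_bigl => y do rewrite inE.
by apply/andP; split; apply: leq_sum => y /f_range/andP[].
Qed.

Lemma modular_irregular_labelingP :
  modular_irregular_labeling k f <->
  edge_labeling k f /\
  forall x y, weight x = weight y %[mod #|vertex G|] -> x = y.
Proof.
split=> [[f_range /bij_inj w_inj]|[f_range w_inj]]; split=> //.
  by move=> x y eq_w; apply: w_inj; apply: val_inj.
by apply: inj_card_bij => [x y [/w_inj]//|]; rewrite card_ord.
Qed.

Lemma sum_modular_weight :
  modular_irregular_labeling k f ->
  \sum_x weight x = 'C(#|vertex G|, 2) %[mod #|vertex G|].
Proof.
move=> [_ f_bij]; rewrite -modn_summ -bin2_sum big_mkord.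
by rewrite [in RHS](reindex (modular_weight f)) //; apply: onW_bij.
Qed.

Lemma modular_irregular_order :
  modular_irregular_labeling k f -> #|vertex G| <> 2 %[mod 4].
Proof.
move=> /sum_modular_weight sum_w order2.
have order_even : odd #|vertex G| = false by lia.
have := congr1 odd sum_w; rewrite !odd_mod // sum_weight oddM /=.
by rewrite odd_bin2.
Qed.

Lemma card_degree_le d :
  modular_irregular_labeling k f -> #|[set x | degree x == d]| <= (k.-1 * d).+1.
Proof.
move=> /modular_irregular_labelingP[f_range w_inj]; set D := [set x | _].
have weight_inj : injective weight.
  by move=> x y eq_w; apply: w_inj; rewrite eq_w.
rewrite cardE -(size_map weight) -(size_iota d (k.-1 * d).+1).
apply: uniq_leq_size; first by rewrite (map_inj_uniq weight_inj) enum_uniq.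
move=> _ /mapP[x + ->]; rewrite mem_enum inE mem_iota => /eqP <-.
by have := weight_bounds x f_range; nia.
Qed.

End ModularLabelings.

Lemma ms_eq_Some G k :
  has_modular_irregular_labeling G k ->
  (forall j, has_modular_irregular_labeling G j -> k <= j) ->
  ms G = Some k.
Proof.
move=> has_k min_k; rewrite /ms; case: pselect => [ex|[]]; last first.
  by exists k; apply/asboolP.
congr Some; case: ex_minnP => m /asboolP has_m min_m.
by apply/eqP; rewrite eqn_leq min_k // min_m //; apply/asboolP.
Qed.

Lemma ms_eq_None G :
  (forall k, ~ has_modular_irregular_labeling G k) -> ms G = None.
Proof.
rewrite /ms => has_none; case: pselect => // ex.
by have [k /asboolP/has_none] := ex.
Qed.

Section BookLabels.
Variable n : nat.
Implicit Types (e k : nat) (x : bool -> 'I_n -> nat).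

Lemma mem_book_edges (u v : book_vertex n) :
  ([set u; v] \in book_edges n) =
  match u, v with
  | inl p, inl q => p != q
  | inr _, inr _ => false
  | _, _ => true
  end.
Proof.
have page_edge p i : [set inl p; inr i] \in book_edges n.
  rewrite inE; apply/orP; right; rewrite inE; apply/orP.
  by case: p; [right|left]; apply/imsetP; exists i.
case: u v => [p|i] [q|j]; rewrite ?page_edge //; last 2 first.
- by rewrite setUC page_edge.
- apply/negbTE/negP => /setU1P[|/setUP[]/imsetP[l _]] /setP eq_ij.
  + by have := eq_ij (inl false); rewrite !inE.
  + by have := eq_ij (inl false); rewrite !inE.
  + by have := eq_ij (inl true); rewrite !inE.
case: (eqVneq p q) => [->|pq].
  by apply/negbTE/negP; rewrite setUid => /book_edges_card; rewrite cards1.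
rewrite /book_edges.
by case: p q pq => [] [] // _; rewrite ?setU11 // setUC setU11.
Qed.

Lemma book_edges_forall (P : {set book_vertex n} -> Prop) :
  (forall E, E \in book_edges n -> P E) <->
  P [set book_a n; book_b n] /\ forall p i, P [set inl p; inr i].
Proof.
split=> [P_edge|[P_spine P_page] E].
  by split=> [|p i]; apply: P_edge; rewrite mem_book_edges.
by case/setU1P=> [->|/setUP[]/imsetP[i _ ->]] //; apply: P_page.
Qed.

Lemma sum_book_vertex (F : book_vertex n -> nat) :
  \sum_v F v = F (book_a n) + F (book_b n) + \sum_i F (book_c i).
Proof. by rewrite big_sumType big_bool [F _ + F _]addnC. Qed.

(* [e] labels the spine [ab]; [x false i] and [x true i] label the edges that
   join [c_i] to [a] and to [b]. *)
Definition book_weight e x (v : book_vertex n) : nat :=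
  match v with
  | inl p => e + \sum_i x p i
  | inr i => x false i + x true i
  end.

Definition book_labeling k e x : Prop :=
  [/\ 1 <= e <= k, forall p i, 1 <= x p i <= k &
      forall u v, book_weight e x u = book_weight e x v %[mod n + 2] -> u = v].

Definition spine_label (f : {set book_vertex n} -> nat) : nat :=
  f [set book_a n; book_b n].

Definition page_label (f : {set book_vertex n} -> nat) p (i : 'I_n) : nat :=
  f [set inl p; inr i].

Definition book_label e x (E : {set book_vertex n}) : nat :=
  if [pick pi : bool * 'I_n | E == [set inl pi.1; inr pi.2]] is Some pi
  then x pi.1 pi.2 else e.

Lemma spine_label_book e x : spine_label (book_label e x) = e.
Proof.
rewrite /spine_label /book_label; case: pickP => // -[p i].
by move=> /eqP/setP/(_ (inr i)); rewrite !inE eqxx.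
Qed.

Lemma page_label_book e x p i : page_label (book_label e x) p i = x p i.
Proof.
rewrite /page_label /book_label; case: pickP => [[q j]|/(_ (p, i))]; last first.
  by rewrite eqxx.
move=> /eqP/setP eq_pi; have := eq_pi (inr i); have := eq_pi (inl p).
by rewrite !inE !eqxx /= orbF => /esym/eqP[->] /esym/eqP[->].
Qed.

Lemma weight_book f v :
  weight (G := triangular_book n) f v =
  book_weight (spine_label f) (page_label f) v.
Proof.
rewrite /weight big_mkcond sum_book_vertex /= !mem_book_edges.
under eq_bigr => i _ do rewrite mem_book_edges.
case: v => [[]|i] /=; rewrite ?add0n ?addn0 //.
- by rewrite setUC.
- by rewrite big1 // addn0 !(setUC [set inr i]).
Qed.

Lemma modular_irregular_bookP k f :
  modular_irregular_labeling (G := triangular_book n) k f <->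
  book_labeling k (spine_label f) (page_label f).
Proof.
split=> [/modular_irregular_labelingP[]|[e_range x_range w_inj]].
  move=> /book_edges_forall[e_range x_range] w_inj; split=> // u v eq_uv.
  by apply: w_inj; rewrite !weight_book card_book_vertex.
apply/modular_irregular_labelingP; split; first by apply/book_edges_forall.
by move=> u v; rewrite !weight_book card_book_vertex => /w_inj.
Qed.

Lemma has_book_labelingP k :
  has_modular_irregular_labeling (triangular_book n) k <->
  exists e x, book_labeling k e x.
Proof.
split=> [[f /modular_irregular_bookP f_lab]|[e [x x_lab]]].
  by exists (spine_label f), (page_label f).
exists (book_label e x); apply/modular_irregular_bookP.
rewrite spine_label_book (_ : page_label _ = x) //.
by apply/funext => p; apply/funext => i; rewrite page_label_book.
Qed.

Lemma degree_book_c i : @degree (triangular_book n) (book_c i) = 2.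
Proof.
by rewrite /degree -sum1_card big_set; have := weight_book (fun=> 1) (book_c i).
Qed.

End BookLabels.

Lemma card_pages_le n k :
  has_modular_irregular_labeling (triangular_book n) k -> n <= (k.-1 * 2).+1.
Proof.
case=> f /(card_degree_le 2); apply: leq_trans.
rewrite -[n in n <= _]card_ord -(card_imset predT (@inr_inj bool 'I_n)).
apply/subset_leq_card/subsetP => _ /imsetP[i _ ->].
by rewrite inE degree_book_c.
Qed.

Lemma no_book_labeling_dvdn4 n k :
  4 %| n -> ~ has_modular_irregular_labeling (triangular_book n) k.
Proof.
by move=> n_dvd4 [f /modular_irregular_order]; rewrite card_book_vertex; lia.
Qed.

Lemma book1_labeling_ge3 k :
  has_modular_irregular_labeling (triangular_book 1) k -> 3 <= k.
Proof.
case/has_book_labelingP => e [x [e_range x_range w_inj]].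
have := x_range false ord0; have := x_range true ord0.
have spine_neq p : e <> x p ord0.
  move=> eq_ex; have // : inl (~~ p) = inr ord0 :> book_vertex 1.
  apply: w_inj; congr (_ %% _); rewrite /= big_ord1.
  by case: p eq_ex => /=; lia.
have page_neq : x false ord0 <> x true ord0.
  move=> eq_x; have // : inl false = inl true :> book_vertex 1.
  by apply: w_inj; congr (_ %% _); rewrite /= !big_ord1 eq_x.
by have := spine_neq false; have := spine_neq true; lia.
Qed.

(* Two labels in [1 .. k] with sum [i + 2] lie between [(i.+1 - k).+1] and
   [minn i.+1 k]; these are the sums of those bounds over [i < n]. *)
Definition min_page_sum n k := n + 'C(n.+1 - k, 2).
Definition max_page_sum n k := 'C(n.+1, 2) - 'C(n.+1 - k, 2).

Lemma sum_min_page_label n k : \sum_(i < n) (i.+1 - k).+1 = min_page_sum n k.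
Proof.
under eq_bigr => i _ do rewrite -add1n.
by rewrite big_split sum_succ_subn sum1_card card_ord.
Qed.

Lemma sum_max_page_label n k : \sum_(i < n) minn i.+1 k = max_page_sum n k.
Proof.
rewrite /max_page_sum -sum_succ -sum_succ_subn -sumnB => [|i _]; last first.
  exact: leq_subr.
by apply: eq_bigr => i _; rewrite minnE.
Qed.

Lemma sum_page_weights n : \sum_(i < n) (i + 2) + 1 = 'C(n + 2, 2).
Proof.
rewrite addn2 -sum_succ big_ord_recl addnC.
by congr (_ + _); apply: eq_bigr => i _; rewrite addn2.
Qed.

Section TightBook.
Variables (n k e : nat) (x : bool -> 'I_n -> nat).
Hypotheses (n_eq : n = 2 * k - 1) (x_lab : book_labeling k e x).

Lemma tight_page_weights :
  exists s : 'S_n, forall i, x false i + x true i = s i + 2.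
Proof.
have [_ x_range w_inj] := x_lab.
have weight_ge2 i : 2 <= x false i + x true i.
  by have := x_range false i; have := x_range true i; lia.
have [|i|s s_eq] := @inj_ltn_perm n (fun i => x false i + x true i - 2).
- move=> i j eq_ij; suff [] : inr i = inr j :> book_vertex n by [].
  apply: w_inj; congr (_ %% _) => /=.
  by have := weight_ge2 i; have := weight_ge2 j; lia.
- by have := x_range false i; have := x_range true i; lia.
by exists s => i; rewrite -s_eq subnK.
Qed.

Lemma tight_page_sum_ge p : min_page_sum n k <= \sum_i x p i.
Proof.
have [_ x_range _] := x_lab; have [s s_eq] := tight_page_weights.
rewrite -sum_min_page_label (reindex_inj (@perm_inj _ s)) /=.
apply: leq_sum => i _; have := x_range false i; have := x_range true i.
by have := s_eq i; case: p; lia.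
Qed.

Lemma tight_page_sumD : \sum_i x false i + \sum_i x true i + 1 = 'C(n + 2, 2).
Proof.
have [s s_eq] := tight_page_weights; rewrite -big_split /=.
under eq_bigr => i _ do rewrite s_eq.
by rewrite -sum_page_weights [in RHS](reindex_inj (@perm_inj _ s)).
Qed.

Lemma tight_spine_weight_mod p : (e + \sum_i x p i) %% (n + 2) <= 1.
Proof.
have [_ _ w_inj] := x_lab; have [s s_eq] := tight_page_weights.
rewrite leqNgt; apply/negP => w_gt1; set w := _ %% _ in w_gt1.
have w_lt : w < n + 2 by rewrite ltn_mod addn2.
have w2_lt : w - 2 < n by lia.
pose i := (s^-1)%g (Ordinal w2_lt).
have // : inl p = inr i :> book_vertex n.
apply: w_inj; rewrite /= s_eq permKV /= subnK //.
by rewrite /w modn_mod.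
Qed.

End TightBook.

Lemma book5_labeling_ge4 k :
  has_modular_irregular_labeling (triangular_book 5) k -> 4 <= k.
Proof.
move=> has_lab; have n_le := card_pages_le has_lab.
rewrite leqNgt; apply/negP => k_lt4; have k_eq3 : k = 3 by lia.
move: has_lab; rewrite {}k_eq3 => /has_book_labelingP[e [x x_lab]].
have n_eq : 5 = 2 * 3 - 1 by [].
have sumD := tight_page_sumD n_eq x_lab; rewrite (_ : 'C(_, _) = 21) // in sumD.
have sum_ge p : 8 <= \sum_i x p i := tight_page_sum_ge n_eq x_lab p.
have a_weight := tight_spine_weight_mod n_eq x_lab false.
have b_weight := tight_spine_weight_mod n_eq x_lab true.
have [e_range _ _] := x_lab.
have e_eq1 : e = 1 by lia.
by have := sum_ge false; have := sum_ge true; lia.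
Qed.

Lemma has_book_labeling_of_residues n k e (x : bool -> 'I_n -> nat) :
  1 <= e <= k -> (forall p i, 1 <= x p i <= k) ->
  (forall i, x false i + x true i = i + 2 %[mod n + 2]) ->
  e + \sum_i x false i = 0 %[mod n + 2] ->
  e + \sum_i x true i = 1 %[mod n + 2] ->
  has_modular_irregular_labeling (triangular_book n) k.
Proof.
move=> e_range x_range c_weight a_weight b_weight; apply/has_book_labelingP.
exists e, x; split=> // u v.
pose residue (w : book_vertex n) :=
  match w with inl p => nat_of_bool p | inr i => i + 2 end.
have residue_inj : injective residue.
  move=> [[]|i] [[]|j] //= eq_ij; try lia.
  by congr inr; apply: val_inj => /=; lia.
have weight_mod w : book_weight e x w = residue w %[mod n + 2].
  by case: w => [[]|i] /=.
have residue_lt w : residue w < n + 2.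
  by case: w => [[]|i]; rewrite /= ?ltn_add2r ?addn2.
by rewrite !weight_mod !modn_small // => /residue_inj.
Qed.

Lemma has_book_labeling_of_page_sum n k e t :
  n < 2 * k -> 1 <= e <= k ->
  'C(n + 2, 2) + 2 * e = 2 %[mod n + 2] ->
  min_page_sum n k <= t <= max_page_sum n k -> n + 2 %| e + t ->
  has_modular_irregular_labeling (triangular_book n) k.
Proof.
move=> n_lt e_range total_mod t_range /dvdnP[q e_plus_t].
rewrite -sum_min_page_label -sum_max_page_label in t_range.
have [i|z z_range sum_z] := exists_sum_eq _ t_range.
  by have := ltn_ord i; lia.
pose x (p : bool) (i : 'I_n) := if p then i + 2 - z i else z i.
have sum_x : \sum_i x true i + t + 1 = 'C(n + 2, 2).
  rewrite -sum_page_weights -sum_z -big_split /=; congr (_ + _).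
  by apply: eq_bigr => i _; have := z_range i; lia.
apply: (@has_book_labeling_of_residues n k e x) => // [p i|i||].
- by have := z_range i; have := ltn_ord i; rewrite /x; case: p; lia.
- by rewrite /x /= subnKC //; have := z_range i; lia.
- by rewrite [X in e + X]sum_z e_plus_t modnMl mod0n.
apply/eqP; rewrite -(eqn_modDr 1) -(modnMDl q) -e_plus_t.
by rewrite (_ : _ + _ = 'C(n + 2, 2) + 2 * e) ?total_mod // -sum_x; lia.
Qed.

Lemma exists_spine_label n :
  ~~ (4 %| n) ->
  exists2 e, 1 <= e <= uphalf n.+1 & 'C(n + 2, 2) + 2 * e = 2 %[mod n + 2].
Proof.
move=> n_ndvd4; have bin_eq := mul2_bin2 (n + 2).
case: (boolP (odd n)) => n_odd.
  exists 1; first lia.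
  have [m n_eq] : exists m, n = 2 * m + 1 by exists n./2; lia.
  by rewrite (_ : 'C(_, _) = m.+1 * (n + 2)) ?modnMDl //; nia.
(* Here ['C(n + 2, 2)] is [(n + 2) / 2] modulo [n + 2], so [2 * e] has to be
   [2 + (n + 2) / 2]. *)
exists (n %/ 4 + 2); first lia.
have [m n_eq] : exists m, n = 4 * m + 2 by exists (n %/ 4); lia.
by rewrite (_ : _ + _ = (2 * m + 2) * (n + 2) + 2) ?modnMDl //; nia.
Qed.

Lemma page_sum_width n k :
  n < 2 * k -> 2 * k <= n + 2 ->
  min_page_sum n k + k.-1 ^ 2 = max_page_sum n k.
Proof.
rewrite /min_page_sum /max_page_sum => n_lt k_le.
have [m k_eq] : exists m, k = m.+1 by exists k.-1; lia.
have bin_eq := mul2_bin2 n.+1; have bin_sub_eq := mul2_bin2 (n.+1 - k).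
rewrite {}k_eq /= -mulnn in bin_sub_eq n_lt k_le *.
have [n_eq|n_eq] : n = 2 * m + 1 \/ n = 2 * m by lia.
- have sub_eq : n.+1 - m.+1 = m.+1 by lia.
  by rewrite {}sub_eq {}n_eq /= in bin_sub_eq bin_eq *; lia.
- have sub_eq : n.+1 - m.+1 = m by lia.
  rewrite {}sub_eq {}n_eq /= in bin_sub_eq bin_eq *.
  by case: m bin_eq bin_sub_eq {n_lt k_le} => [|m] //=; lia.
Qed.

Lemma has_book_labeling_ge6 n :
  5 < n -> ~~ (4 %| n) ->
  has_modular_irregular_labeling (triangular_book n) (uphalf n.+1).
Proof.
move=> n_gt5 n_ndvd4; set k := uphalf n.+1.
have n_lt : n < 2 * k by lia.
have [e e_range total_mod] := exists_spine_label n_ndvd4.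
have width : min_page_sum n k + (n + 2).-1 <= max_page_sum n k.
  by rewrite -(page_sum_width n_lt) ?leq_add2l; nia.
have [|t t_range dvd_e_plus_t] := exists_dvdn_addn_between e _ width; first lia.
exact: (has_book_labeling_of_page_sum n_lt e_range total_mod t_range).
Qed.

Lemma has_book1_labeling : has_modular_irregular_labeling (triangular_book 1) 3.
Proof.
pose x (p : bool) (i : 'I_1) := if p then 3 else 2.
apply: (@has_book_labeling_of_residues 1 3 1 x) => //.
- by case.
- by move=> i; rewrite ord1.
- by rewrite big_ord1.
- by rewrite big_ord1.
Qed.

Lemma has_book_labeling n :
  n != 1 -> n != 5 -> ~~ (4 %| n) ->
  has_modular_irregular_labeling (triangular_book n) (uphalf n.+1).
Proof.
move=> n_neq1 n_neq5 n_ndvd4; have [n_le5|n_gt5] := leqP n 5; last first.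
  exact: has_book_labeling_ge6.
have [->|->] : n = 2 \/ n = 3 by lia.
  exact: (@has_book_labeling_of_page_sum 2 2 2 2).
exact: (@has_book_labeling_of_page_sum 3 2 1 4).
Qed.

Theorem theorem2 (n : nat) (hn : 1 <= n) :
  ms (triangular_book n) =
    if n == 1 then Some 3
    else if n == 5 then Some 4
    else if n == 0 %[mod 4] then None
    else Some (uphalf n.+1).
Proof.
case: (eqVneq n 1) => [->|n_neq1].
  exact: ms_eq_Some has_book1_labeling book1_labeling_ge3.
case: (eqVneq n 5) => [->|n_neq5].
  apply: ms_eq_Some book5_labeling_ge4.
  exact: (@has_book_labeling_of_page_sum 5 4 1 6).
rewrite mod0n -/(4 %| n); have [n_dvd4|n_ndvd4] := boolP (4 %| n).
  by apply: ms_eq_None => k; apply: no_book_labeling_dvdn4.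
by apply: ms_eq_Some => [|j /card_pages_le]; [apply: has_book_labeling | lia].
Qed.
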